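(* Let $X$ be a completely regular Hausdorff space. The following statements are equivalent. (a) $X$ is an EZ-space (i.e., $X$ has a clopen $\pi$-base). (b) For every ideal $I$ of $C(X)$ there exists a subset $S$ of idempotent elements of $C(X)$ such that $\mathrm{Ann}(I)=\mathrm{Ann}(S)$. (c) For every $f\in C(X)$ there exists a subset $S$ of idempotent elements of $C(X)$ such that $\mathrm{Ann}(f)=\mathrm{Ann}(S)$. (d) For every cozero-set $H$ of $X$ there exists a collection $\{H_{\alpha}:\alpha\in S\}$ of clopen subsets of $X$ such that $\mathrm{cl}_X H=\mathrm{cl}_X\big(\bigcup_{\alpha\in S}H_{\alpha}\big)$.
   Context: $C(X)$ is the ring of all real-valued continuous functions on $X$. For a subset $S$ of a commutative ring $R$, $\mathrm{Ann}(S)=\{r\in R: rs=0 \text{ for all } s\in S\}$, and $\mathrm{Ann}(f)=\mathrm{Ann}(\{f\})$. A cozero-set of $X$ is a set $\mathrm{coz}(f)=\{x: f(x)\neq 0\}$ with $f\in C(X)$. A topological space $X$ is an EZ-space if for every open subset $A$ of $X$ there is a collection $\{A_\alpha:\alpha\in S\}$ of clopen subsets of $X$ with $\mathrm{cl}_X A=\mathrm{cl}_X(\bigcup_{\alpha\in S}A_\alpha)$. A clopen $\pi$-base of $X$ is a collection of nonempty clopen sets such that every nonempty open subset of $X$ contains a member of the collection. *)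

(* Defs.v *)
From HB Require Import structures.
From mathcomp Require Import all_boot all_order all_algebra.
From mathcomp Require Import all_classical all_reals all_analysis.

Set Implicit Arguments.
Unset Strict Implicit.
Unset Printing Implicit Defensive.

Import Order.TTheory GRing.Theory Num.Theory.
Import numFieldNormedType.Exports.

Local Open Scope classical_set_scope.
Local Open Scope ring_scope.

(* C(X) is [continuousType X R].  It gets its commutative ring structure as a
   subring of the pointwise ring [X -> R]; it is only a [comPzRingType] because
   X may be empty, in which case C(X) is the zero ring. *)
Definition cts_pred (X : topologicalType) (R : realType) : {pred X -> R} :=
  mem [set f : X -> R | continuous f].
Arguments cts_pred : clear implicits.

Section continuous_ring.
Context {X : topologicalType} {R : realType}.
Implicit Types f g : continuousType X R.

Definition cts_sub (f : X -> R) (Pf : f \in cts_pred X R) :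
  continuousType X R := mkcts (set_mem Pf : continuous f).

Let cts_rect (K : continuousType X R -> Type) :
  (forall f Pf, K (@cts_sub f Pf)) -> forall u : continuousType X R, K u.
Proof.
move=> Ksub f; have Pf : (f : X -> R) \in cts_pred X R.
  by apply/mem_set; exact: cts_fun.
by have -> : f = cts_sub Pf by exact/continuousEP.
Qed.

Let cts_subK (f : X -> R) (Pf : f \in cts_pred X R) :
  (cts_sub Pf : X -> R) = f.
Proof. by []. Qed.

HB.instance Definition _ := @isSub.Build (X -> R) (cts_pred X R)
  (continuousType X R) (fun f => f : X -> R) cts_sub cts_rect cts_subK.

Lemma cts_pred_subring : subring_closed (cts_pred X R).
Proof.
split=> [|f g /set_mem cf /set_mem cg|f g /set_mem cf /set_mem cg].
- by apply/mem_set => x; exact: cvg_cst.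
- by apply/mem_set => x; apply: cvgB; [exact: cf|exact: cg].
- by apply/mem_set => x; apply: cvgM; [exact: cf|exact: cg].
Qed.

HB.instance Definition _ :=
  GRing.SubChoice_isSubComPzRing.Build (X -> R) (cts_pred X R) (continuousType X R)
    cts_pred_subring.

Lemma ctsDE f g x : (f + g) x = f x + g x. Proof. by []. Qed.
Lemma ctsME f g x : (f * g) x = f x * g x. Proof. by []. Qed.
Lemma ctsNE f x : (- f) x = - f x. Proof. by []. Qed.
Lemma cts0E x : (0 : continuousType X R) x = 0. Proof. by []. Qed.
Lemma cts1E x : (1 : continuousType X R) x = 1. Proof. by []. Qed.

End continuous_ring.

(* The library states complete regularity with uniform separators; this is the
   usual formulation with real-valued functions. *)
Lemma completely_regularP (R : realType) (X : topologicalType) :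
  completely_regular_space X <->
  forall (a : X) (B : set X), closed B -> ~ B a ->
    exists f : X -> R, [/\ continuous f, range f `<=` `[0, 1],
      f a = 0 & forall b, B b -> f b = 1].
Proof.
split=> crX a B cB nBa.
  have /(@uniform_separatorP _ R) := crX a B cB nBa.
  case=> f [cf f01 fa fB]; exists f; split=> //.
    by apply: fa; exists a.
  by move=> b Bb; apply: fB; exists b.
have [f [cf f01 fa fB]] := crX a B cB nBa.
apply/(@uniform_separatorP _ R); exists f; split=> // _ [x /= xA <-].
  by rewrite xA.
exact: fB.
Qed.

(* Neither properness nor decidability is required, unlike for the library's
   [idealr]. *)
Definition is_ideal (A : comPzRingType) (I : set A) : Prop :=
  [/\ I 0, (forall a b, I a -> I b -> I (a + b)) & (forall r a, I a -> I (r * a))].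

Definition Ann (A : comPzRingType) (S : set A) : set A :=
  [set r | forall s, S s -> r * s = 0].

Definition idempotent_elt (A : comPzRingType) : set A := [set e | e * e = e].

Definition coz (X : topologicalType) (R : realType) (f : continuousType X R) :
  set X := [set x | f x != 0].

Definition EZ_space (X : topologicalType) : Prop :=
  forall A : set X, open A ->
    exists2 F : set (set X), F `<=` clopen &
      closure A = closure (\bigcup_(B in F) B).

Definition clopen_pi_base (X : topologicalType) (P : set (set X)) : Prop :=
  (forall B, P B -> clopen B /\ B !=set0) /\
  (forall U, open U -> U !=set0 -> exists2 B, P B & B `<=` U).

(* Main.v *)
(* Everything goes through the condition that each nonempty open set contains a
   nonempty clopen set. Membership in Ann S only says that a function vanishes
   on the union of the cozero-sets of S, and by complete regularity such
   functions see exactly the closure of that union; idempotents are the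
   indicators of clopen sets. *)
Require Import Defs.
From mathcomp Require Import all_boot all_order all_algebra.
From mathcomp Require Import all_classical all_reals all_analysis.

Import Order.TTheory GRing.Theory Num.Theory.
Import numFieldNormedType.Exports.

Local Open Scope classical_set_scope.
Local Open Scope ring_scope.

Lemma open_coz (R : realType) (X : topologicalType) (f : continuousType X R) :
  open (coz f).
Proof.
have -> : coz f = f @^-1` (~` [set 0]).
  by apply/seteqP; split=> x /= /eqP.
apply: open_comp; first by move=> x _; exact: cts_fun.
exact/closed_openC/closed_eq.
Qed.

(** Cancelling a nonzero value in [e x * e x = e x] leaves 1, so the open set [coz e] is also the
    preimage of the closed set {1}. *)
Lemma clopen_coz (R : realType) (X : topologicalType)
  (e : continuousType X R) : idempotent_elt e -> clopen (coz e).
Proof.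
move=> ee; split; first exact: open_coz.
have -> : coz e = e @^-1` [set 1].
  apply/seteqP; split=> x /=.
    move=> ex0; apply: (mulfI ex0); rewrite mulr1.
    exact: (congr1 (fun g : continuousType X R => g x) ee).
  by rewrite /coz /= => ->; exact: oner_neq0.
apply: preimage_closed; last exact: closed_eq.
by move=> x _; exact: cts_fun.
Qed.

Lemma continuous_indic_clopen (R : realType) (X : topologicalType) (B : set X) :
  clopen B -> continuous (\1_B : X -> R).
Proof.
move=> [oB cB] x; rewrite /continuous_at.
have [Bx|nBx] := pselect (B x).
  apply: cvg_near_cst; have : nbhs x B by exact: open_nbhs_nbhs.
  by apply: filterS => y By; rewrite !indicE !mem_set.
apply: cvg_near_cst; have : nbhs x (~` B).
  by apply: open_nbhs_nbhs; split=> //; exact: closed_openC.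
by apply: filterS => y By; rewrite !indicE !memNset.
Qed.

Lemma idempotent_indic (R : realType) (X : topologicalType) (B : set X) :
  clopen B ->
  exists2 e : continuousType X R, idempotent_elt e & coz e = B.
Proof.
move=> cB; pose e : continuousType X R := mkcts (@continuous_indic_clopen R X B cB).
have eE x : e x = (x \in B)%:R by rewrite -indicE.
exists e.
  apply/continuousEP => x; rewrite ctsME eE.
  by case: (x \in B); rewrite ?mulr1 ?mulr0.
apply/seteqP; split=> x; rewrite /coz /= eE pnatr_eq0 eqb0 negbK.
  by move/set_mem.
by move/mem_set.
Qed.

(** Products are pointwise and [R] has no zero divisors. Hence [Ann S] depends on [S] only through
    the union of its cozero-sets. *)
Lemma AnnE (R : realType) (X : topologicalType)
    (S : set (continuousType X R)) (f : continuousType X R) :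
  Ann S f <-> forall x, (\bigcup_(s in S) coz s) x -> f x = 0.
Proof.
split=> [Sf x [s Ss sx]|f0 s Ss].
  apply: (mulIf sx); rewrite mul0r.
  exact: (congr1 (fun g : continuousType X R => g x) (Sf _ Ss)).
apply/continuousEP => x; rewrite ctsME cts0E.
have [->|sx] := eqVneq (s x) 0; first by rewrite mulr0.
by rewrite f0 ?mul0r//; exists s.
Qed.

Lemma closure_eq_le (T : topologicalType) (A B : set T) :
  A `<=` closure B -> closure A `<=` closure B.
Proof.
by move=> AB; rewrite [X in _ `<=` X](closure_id _).1;
  [exact: closure_subset|exact: closed_closure].
Qed.

(** A point of [coz t] outside the right-hand closure would be separated from it by some [f]; then
    [1 - f] annihilates [S] but equals 1 at that point, so it does not annihilate [T]. *)
Lemma closure_coz_le_Ann (R : realType) (X : topologicalType)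
    (S T : set (continuousType X R)) : completely_regular_space X ->
  Ann S `<=` Ann T ->
  closure (\bigcup_(t in T) coz t) `<=` closure (\bigcup_(s in S) coz s).
Proof.
move=> /(completely_regularP R) crX ST; apply: closure_eq_le => x Tx.
apply: contrapT => nSx.
have [f [cf _ fx fS]] := crX x _ (@closed_closure _ _) nSx.
pose g : continuousType X R := 1 - (mkcts cf : continuousType X R).
have gE y : g y = 1 - f y by [].
have /AnnE : Ann T g.
  by apply: ST; apply/AnnE => y /subset_closure /fS fy; rewrite gE fy subrr.
by move=> /(_ x Tx)/eqP; rewrite gE fx subr0 oner_eq0.
Qed.

(** A form of the clopen pi-base condition that names no collection: the family of all nonempty
    clopen sets serves as the base. *)
Definition has_clopen_subsets (X : topologicalType) :=
  forall U : set X, open U -> U !=set0 ->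
    exists B, [/\ clopen B, B !=set0 & B `<=` U].

Lemma has_clopen_subsets_pi_base (X : topologicalType) :
  has_clopen_subsets X <-> exists P : set (set X), clopen_pi_base P.
Proof.
split=> [cX|[P [Pc PU]] U oU U0].
  exists [set B | clopen B /\ B !=set0]; split=> // U oU U0.
  by have [B [? ? ?]] := cX U oU U0; exists B.
by have [B PB BU] := PU U oU U0; have [? ?] := Pc B PB; exists B.
Qed.

(** The clopen subsets of [A] have a union dense in [A]: around a point of [A], every open
    neighbourhood meets [A] in a nonempty open set, which contains a nonempty clopen one. *)
Lemma has_clopen_subsets_EZ (X : topologicalType) :
  has_clopen_subsets X -> EZ_space X.
Proof.
move=> cX A oA; exists [set B | clopen B /\ B `<=` A]; first by move=> B [].
apply/seteqP; split; last by apply: closure_subset => x [B [_ BA] /BA].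
apply: closure_eq_le => x Ax V /nbhs_interior Vx.
have [|B [cB [y By] BU]] := cX (A `&` V°) (openI oA (open_interior V)).
  by exists x; split=> //; exact: nbhs_singleton.
exists y; split; last by apply: interior_subset; exact: (BU y By).2.
by exists B => //; split=> // z /BU[].
Qed.

Lemma coz_EZ_has_clopen_subsets (R : realType) (X : topologicalType) :
  completely_regular_space X ->
  (forall H : set X, (exists f : continuousType X R, H = coz f) ->
     exists2 F : set (set X), F `<=` clopen &
       closure H = closure (\bigcup_(B in F) B)) ->
  has_clopen_subsets X.
Proof.
move=> /(completely_regularP R) crX HF U oU [x Ux].
have [|f [cf _ fx fU]] := crX x (~` U) (open_closedC oU); first exact.
(* [1/2 - f] truncated at 0: the closure of its cozero-set stays inside [U]. *)
have cg : continuous (fun y => Num.max (2^-1 - f y) 0).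
  move=> y; apply: (@continuous_max _ _ (fun y => 2^-1 - f y) (cst 0)).
    by apply: cvgB; [exact: cvg_cst|exact: cf].
  exact: cvg_cst.
pose g : continuousType X R := mkcts cg.
have gE y : g y = Num.max (2^-1 - f y) 0 by [].
pose H := coz g.
have [|F Fc HE] := HF H; first by exists g.
have HU : closure H `<=` U.
  (* On [H], [f] is at most 1/2, a closed condition that passes to the closure, whereas [f] is 1 off
     [U]. *)
  have cD : closed (f @^-1` [set r | r <= 2^-1]).
    by apply: preimage_closed; [move=> y _; exact: cf|exact: closed_le].
  move=> y Hy; apply: contrapT => /fU fy.
  have : (f @^-1` [set r | r <= 2^-1]) y.
    rewrite ((closure_id _).1 cD); apply: closure_subset Hy => z.
    rewrite /H /coz /= gE => /eqP gz; rewrite leNgt; apply/negP => fz.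
    by apply: gz; apply/max_idPr; rewrite subr_le0 ltW.
  by rewrite /= fy leNgt invf_lt1// ltr1n.
have Hx : H x.
  by rewrite /H /coz /= gE fx subr0 (max_idPl _) ?invr_ge0// invr_eq0 pnatr_eq0.
have : closure (\bigcup_(B in F) B) x by rewrite -HE; exact: subset_closure.
(* The neighbourhood [H] of [x] meets some member [B] of [F]. All of [B] lies in the closure of the
   union, which is [closure H], hence in [U]. *)
move=> /(_ H (open_nbhs_nbhs (conj (open_coz _ _ _) Hx)))[y [[B FB By] _]].
exists B; split; [exact: Fc|by exists y|].
apply: subset_trans HU; rewrite HE.
by apply: subset_trans (@subset_closure _ _) => z Bz; exists B.
Qed.

(** [S] consists of the idempotents supported in the union [U] of the cozero-sets of [I]. If [f]
    annihilates [S] but is nonzero somewhere on [U], a nonempty clopen subset of [U] on which [f]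
    never vanishes gives an idempotent of [S] that [f] does not kill. *)
Lemma has_clopen_subsets_Ann (R : realType) (X : topologicalType)
    (I : set (continuousType X R)) : has_clopen_subsets X ->
  exists2 S : set (continuousType X R),
    S `<=` @idempotent_elt (continuousType X R) & Ann I = Ann S.
Proof.
move=> cX; pose U := \bigcup_(s in I) coz s.
exists [set e | idempotent_elt e /\ coz e `<=` U]; first by move=> e [].
apply/seteqP; split=> f /AnnE f0; apply/AnnE => x.
  by move=> [e [_ eU] /eU]; exact: f0.
move=> Ux; apply/eqP/negPn/negP => fx.
have oV : open (U `&` coz f).
  by apply: openI; [apply: bigcup_open => s _|]; exact: open_coz.
have [|B [cB [y By] BV]] := cX _ oV; first by exists x.
have [e ide eB] := @idempotent_indic R X B cB.
have [_ /eqP] := BV y By; apply; apply: f0.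
by exists e; rewrite ?eB//; split=> //; rewrite eB => z /BV[].
Qed.

Lemma Ann_principal (A : comPzRingType) (a : A) :
  Ann [set r * a | r in [set: A]] = Ann [set a].
Proof.
apply/seteqP; split=> r ra s.
  by move=> ->; apply: ra; exists 1; rewrite ?mul1r.
by move=> [t _ <-]; rewrite mulrCA (ra a erefl) mulr0.
Qed.

Lemma is_ideal_principal (A : comPzRingType) (a : A) :
  is_ideal [set r * a | r in [set: A]].
Proof.
split=> [|_ _ [r _ <-] [s _ <-]|r _ [s _ <-]].
- by exists 0; rewrite ?mul0r.
- by exists (r + s); rewrite ?mulrDl.
- by exists (r * s); rewrite ?mulrA.
Qed.

Theorem theorem3p7 (R : realType) (X : topologicalType)
    (crX : completely_regular_space X) (hausX : hausdorff_space X) :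
  (EZ_space X <-> exists P : set (set X), clopen_pi_base P) /\
  [<-> (* a *) EZ_space X;
       (* b *) forall I : set (continuousType X R), is_ideal I ->
                 exists2 S : set (continuousType X R),
                   S `<=` @idempotent_elt (continuousType X R) & Ann I = Ann S;
       (* c *) forall f : continuousType X R,
                 exists2 S : set (continuousType X R),
                   S `<=` @idempotent_elt (continuousType X R) &
                   Ann [set f] = Ann S;
       (* d *) forall H : set X, (exists f : continuousType X R, H = coz f) ->
                 exists2 F : set (set X), F `<=` clopen &
                   closure H = closure (\bigcup_(B in F) B)].
Proof.
have ad : EZ_space X -> forall H : set X,
    (exists f : continuousType X R, H = coz f) ->
    exists2 F : set (set X), F `<=` clopen &
      closure H = closure (\bigcup_(B in F) B).
  by move=> EZ H [f ->]; exact/EZ/open_coz.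
(* The forward direction passes through (d), since cozero-sets are already enough to produce clopen
   subsets. *)
have EZP : EZ_space X <-> has_clopen_subsets X.
  split; last exact: has_clopen_subsets_EZ.
  by move/ad; exact: coz_EZ_has_clopen_subsets.
split; first by rewrite EZP; exact: has_clopen_subsets_pi_base.
tfae.
- by move=> /EZP cX I _; exact: has_clopen_subsets_Ann.
(* A single function has the same annihilator as the principal ideal it generates. *)
- move=> IS f; rewrite -Ann_principal; apply: IS.
  exact: is_ideal_principal.
- move=> fS _ [f ->]; have [S idS AfS] := fS f.
  exists [set coz e | e in S].
    by move=> _ [e /idS ide <-]; exact: clopen_coz.
  (* With [coz f] written as a union over {[f]}, equality of the annihilators gives both inclusions
     of closures. *)
  rewrite bigcup_image -(bigcup_set1 (@coz X R) f).
  by apply/seteqP; split; apply: closure_coz_le_Ann; rewrite ?AfS.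
- by move=> /(coz_EZ_has_clopen_subsets _ _ crX)/EZP.
Qed.
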